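(* For every odd prime $p$, the least primitive root $h(p)$ modulo $p^2$ satisfies $h(p) < p^{0.99}$.
   Context: For an odd prime $p$, $h(p)$ denotes the least positive integer that is a primitive root modulo $p^2$, i.e. the least positive integer whose residue class generates the multiplicative group $(\mathbb{Z}/p^2\mathbb{Z})^\times$. *)

(* Defs.v *)
From mathcomp Require Import all_boot all_order all_fingroup all_algebra all_solvable.

Set Implicit Arguments.
Unset Strict Implicit.
Unset Printing Implicit Defensive.

Import GroupScope GRing.Theory.

Local Open Scope nat_scope.

(* Meaningful for 1 < n only, since 'Z_0 and 'Z_1 are convertible to 'Z_2. *)
Definition primitive_root (n g : nat) : bool :=
  [exists u : {unit 'Z_n},
    (val u == g%:R%R :> 'Z_n) && generator (units_Zp n) u].

Lemma cyclic_units_Zp_sqr (p : nat) :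
  prime p -> odd p -> cyclic (units_Zp (p ^ 2)).
Proof.
move=> pr_p odd_p; have p_gt0 := prime_gt0 pr_p.
have p2_gt1 : 1 < p ^ 2 by rewrite (ltn_exp2l 0) ?prime_gt1.
pose a : 'Z_(p ^ 2) := Zp1.
have oa : #[a] = p ^ 2 by rewrite /a order_Zp1 Zp_cast.
have pa : p.-group <[a]> by rewrite /pgroup -[#|_|]/(#[a]) oa pnatX pnat_id.
have nta : <[a]> :!=: 1%g by rewrite trivg_card1 -[#|_|]/(#[a]) oa gtn_eqF.
have [m [_ _ strA]] := cyclic_pgroup_Aut_structure pa (cycle_cyclic a) nta.
have n1 : (logn p #|<[a]>|).-1 = 1 by rewrite -[#|_|]/(#[a]) oa pfactorK.
move: strA; rewrite n1 odd_p => -[t [_ _ _ [[cycA _] _ _]]].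
by rewrite -oa (isog_cyclic (Zp_unit_isog a)).
Qed.

Lemma ex_primitive_root_sqr (p : nat) :
  prime p -> odd p -> exists g, (0 < g) && primitive_root (p ^ 2) g.
Proof.
move=> pr_p odd_p.
have p2_gt1 : 1 < p ^ 2 by rewrite (ltn_exp2l 0) ?prime_gt1.
have /cyclicP[u genu] := cyclic_units_Zp_sqr pr_p odd_p.
exists (val u + p ^ 2); rewrite addn_gt0 (ltnW p2_gt1) orbT /=.
apply/existsP; exists u; rewrite /generator genu eqxx andbT.
by rewrite natrD natr_Zp pchar_Zp ?addr0.
Qed.

Definition least_primitive_root_sqr (p : nat) (pr_p : prime p) (odd_p : odd p) : nat :=
  ex_minn (ex_primitive_root_sqr pr_p odd_p).

(* Main.v *)
Require Import Defs.
From Stdlib Require Import BinNat Nnat Pnat.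
From mathcomp Require Import all_boot all_order all_algebra.
From mathcomp Require Import all_fingroup all_solvable all_field.
From mathcomp Require Import ring lra zify.
From mathcomp Require Import reals exp.

(* A primitive root [n] mod [p] is a primitive root mod [p^2] unless
   [n^(p-1) = 1 mod p^2].  Quotients [a/b] of two such bad numbers below [p] are
   squares in the subgroup of order [p-1] of the units mod [p^2], and two of them
   agree only if they are equal as fractions; sorting the pairs [(a, b)] by their
   gcd shows that there are only [O(p^(3/4))] bad primitive roots below [p].

   It remains to find more primitive roots than that below [p^0.99].  For
   [p >= 3 * 10^6], count the pairs [a, b <= p^0.99 / 2] such that [a + b] is a
   primitive root: for a nontrivial character the bilinear sum of [chi (a + b)]
   is at most [sqrt p] times the number of [a], by Cauchy-Schwarz and
   orthogonality of translates, without the logarithm of Polya-Vinogradov.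
   For [9000 <= p < 3 * 10^6] no cancellation is needed: [p^(-0.01)] is so close
   to 1 that the [phi (p-1)] primitive roots do not fit in [(p^0.99, p)].  The
   primes below 9000 are checked by computation. *)

Import Order.TTheory GRing.Theory Num.Theory.
Local Open Scope ring_scope.

Set Implicit Arguments.
Unset Strict Implicit.
Unset Printing Implicit Defensive.

(** * Fermat quotients *)

Lemma eq_Fp_nat (p a b : nat) : prime p ->
  (a%:R == b%:R :> 'F_p) = (a == b %[mod p])%N.
Proof. by move=> prp; rewrite -val_eqE /= !val_Fp_nat. Qed.

(** In [a^p - b^p = (a - b) * sum], the sum has [p] terms, each congruent to [a^(p-1)] modulo [p],
    so both factors are divisible by [p]. *)
Lemma eq_exp_mod_sqr (p a b : nat) : prime p ->
  (a = b %[mod p] -> a ^ p = b ^ p %[mod p ^ 2])%N.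
Proof.
move=> prp; wlog ba : a b / (b <= a)%N => [W|/eqP ab].
  by case: (leqP b a) => [|/ltnW] /W // H /esym /H.
apply/eqP; rewrite eqn_mod_dvd ?leq_exp2r ?prime_gt0 // subn_exp.
rewrite -mulnn dvdn_mul //; first by rewrite -eqn_mod_dvd.
have chp := pchar_Fp prp.
rewrite (dvdn_pcharf chp) natr_sum.
move: ab; rewrite -eq_Fp_nat // => /eqP ab.
under eq_bigr => i _.
  rewrite natrM !natrX ab -exprD.
  set e := (_ + _)%N; have -> : e = p.-1 by rewrite /e; have := ltn_ord i; lia.
  over.
by rewrite sumr_const card_ord -[_ *+ p]mulr_natr (pcharf0 chp) mulr0.
Qed.

(** Telescoping, from [1/(i+1)^2 <= 1/i - 1/(i+1)]. *)
Lemma sum_inv_sqr_le (R : realFieldType) (K M : nat) : (0 < K)%N -> (K <= M)%N ->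
  \sum_(K <= i < M) (i.+1%:R ^+ 2)^-1 <= K%:R^-1 :> R.
Proof.
move=> K0 KM; apply: le_trans (_ : \sum_(K <= i < M) (- i.+1%:R^-1 - (- i%:R^-1)) <= _).
  rewrite big_nat_cond [leRHS]big_nat_cond; apply: ler_sum => i /andP[/andP[Ki _] _].
  have i0 : 0 < i%:R :> R by rewrite ltr0n (leq_trans K0).
  rewrite -natr1 -subr_ge0.
  have -> : - (i%:R + 1)^-1 - - i%:R^-1 - ((i%:R + 1) ^+ 2)^-1
      = (i%:R * (i%:R + 1) ^+ 2)^-1 :> R.
    by field; lra.
  by rewrite invr_ge0 mulr_ge0 ?sqr_ge0 // ltW.
by rewrite telescope_sumr // opprK addrC gerDl oppr_le0 invr_ge0 ler0n.
Qed.

Section Energy.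
Variables (p q H : nat) (T : {set 'I_q}).
Hypotheses (prp : prime p) (oddp : odd p) (Hp : (H < p)%N).
Hypothesis T_range : forall a, a \in T -> (0 < a <= H)%N.
Hypothesis T_fermat : forall a, a \in T -> (a ^ p = a %[mod p ^ 2])%N.
Hypothesis T_nonsquare : forall a, a \in T -> (a%:R : 'F_p) ^+ (p.-1)./2 = -1.

Let X g := [set x in setX T T | gcdn x.1 x.2 == g].

(** The map [(a, b) -> a / b] sends [X g] into the roots of [x^((p-1)/2) = 1], since both powers
    equal -1. It is injective: [ad = cb] modulo [p] lifts to [p^2] by taking [p]-th powers, which
    fix [T], and then holds in the integers, both sides being below [p^2]. *)
Lemma card_gcd_pairs_roots g : (#|X g| <= (p.-1)./2)%N.
Proof.
have m0 : (0 < (p.-1)./2)%N by have := odd_prime_gt2 oddp prp; lia.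
have Tn0 (a : 'I_q) : a \in T -> (a%:R : 'F_p) != 0.
  move=> aT; apply/eqP => a0; have := T_nonsquare aT.
  by rewrite a0 expr0n eqn0Ngt m0 /= => /eqP; rewrite eq_sym oppr_eq0 oner_eq0.
pose f (x : 'I_q * 'I_q) : 'F_p := x.1%:R / x.2%:R.
have inj : {in X g &, injective f}.
  move=> [a b] [c d]; rewrite !inE /= => /andP[/andP[aT bT] /eqP gab] /andP[/andP[cT dT] /eqP gcd].
  rewrite /f /= => /eqP; rewrite eqr_div ?Tn0 // -!natrM eq_Fp_nat // => /eqP.
  move/(eq_exp_mod_sqr prp); rewrite !expnMn.
  rewrite -modnMm !T_fermat // modnMm -[in RHS]modnMm !T_fermat // modnMm.
  have lt_p e : e \in T -> (e < p)%N by move=> /T_range/andP[_ eH]; apply: leq_ltn_trans eH Hp.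
  rewrite !modn_small; try by rewrite -mulnn ltn_mul ?lt_p.
  move=> adcb; have b0 := T_range bT.
  (* The two sides are [g * d] and [g * b], so equal gcds force [b = d], and then [a = c]. *)
  have : (gcdn (a * d) (b * d) = gcdn (c * b) (d * b))%N by rewrite adcb [(d * b)%N]mulnC.
  rewrite -!muln_gcdl gab gcd => /eqP; rewrite eqn_pmul2l; last first.
    by rewrite -gab gcdn_gt0; case/andP: b0 => ->; rewrite orbT.
  move/eqP/val_inj => db; rewrite db in adcb *.
  by move/eqP: adcb; rewrite eqn_pmul2r; [move/eqP/val_inj -> | case/andP: b0].
rewrite -(card_in_imset inj) cardE; apply: max_unity_roots => //; last exact: enum_uniq.
apply/allP => y; rewrite mem_enum => /imsetP[[a b]].
rewrite !inE /= => /andP[/andP[aT bT] _] ->; apply/unity_rootP.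
by rewrite expr_div_n !T_nonsquare // divff // oppr_eq0 oner_eq0.
Qed.

(** Dividing both entries by [g] embeds [X g] into the pairs from [1..H/g]. *)
Lemma card_gcd_pairs_range g : (0 < g)%N -> (#|X g| <= (H %/ g) ^ 2)%N.
Proof.
move=> g0; pose f (x : 'I_q * 'I_q) := (val x.1 %/ g, val x.2 %/ g)%N.
have Xd (x : 'I_q * 'I_q) : x \in X g -> [/\ x.1 \in T, x.2 \in T, g %| x.1 & g %| x.2]%N.
  by rewrite !inE => /andP[/andP[-> ->] /eqP <-]; rewrite dvdn_gcdl dvdn_gcdr.
have u : uniq (map f (enum (X g))).
  rewrite map_inj_in_uniq ?enum_uniq // => -[a b] [c d].
  rewrite !mem_enum => /Xd[/= _ _ ga gb] /Xd[/= _ _ gc gd] [ac bd].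
  congr (_, _); apply: val_inj => /=.
    by rewrite -(divnK ga) ac divnK.
  by rewrite -(divnK gb) bd divnK.
rewrite cardE -(size_map f) -mulnn -[X in (_ <= X * X)%N](size_iota 1) -(size_allpairs pair).
apply: uniq_leq_size => // y /mapP[x]; rewrite mem_enum => /Xd[aT bT ga gb] ->.
apply/allpairsP; exists (f x); rewrite /f /= !mem_iota !add1n !ltnS.
have /andP[a0 aH] := T_range aT; have /andP[b0 bH] := T_range bT.
by rewrite !divn_gt0 ?leq_div2r ?(dvdn_leq a0 ga) ?(dvdn_leq b0 gb).
Qed.

(* Pairs with [gcd <= K] are counted through their quotients, which are squares
   modulo [p]; pairs with a larger [gcd] are counted trivially. *)
Lemma card_fermat_le K : (0 < K)%N ->
  (K * #|T| ^ 2 <= K ^ 2 * (p.-1)./2 + H ^ 2)%N.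
Proof.
move=> K0.
have -> : (#|T| ^ 2 = \sum_(0 <= g < H) #|X g.+1|)%N.
  transitivity (\sum_(x in setX T T) \sum_(0 <= g < H) (gcdn x.1 x.2 == g.+1))%N.
    rewrite -mulnn -cardsX -sum1_card; apply: eq_bigr => x.
    rewrite inE => /andP[/T_range/andP[a0 aH] _].
    have g0 : (0 < gcdn x.1 x.2)%N by rewrite gcdn_gt0 a0.
    have gH : (gcdn x.1 x.2 <= H)%N by apply: leq_trans aH; rewrite dvdn_leq ?dvdn_gcdl.
    have gH1 : ((gcdn x.1 x.2).-1 < H)%N by rewrite prednK.
    rewrite big_mkord (bigD1 (Ordinal gH1)) //= prednK // eqxx big1 // => i.
    by rewrite -val_eqE /= => ig; case: eqP => // gi; rewrite gi eqxx in ig.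
  rewrite exchange_big /=; apply: eq_bigr => g _.
  rewrite -sum1dep_card [RHS](eq_bigl (fun x => (x \in setX T T) && (gcdn x.1 x.2 == g.+1))).
    by rewrite big_mkcondr; apply: eq_bigr => x _; case: eqP.
  by move=> x; rewrite !inE.
have [HK|KH] := leqP H K.
  apply: leq_trans (leq_addr _ _); rewrite -mulnn -mulnA leq_mul2l; apply/orP; right.
  apply: leq_trans (_ : \sum_(0 <= g < H) (p.-1)./2 <= _)%N.
    by apply: leq_sum => g _; exact: card_gcd_pairs_roots.
  by rewrite sum_nat_const_nat subn0 leq_mul2r HK orbT.
rewrite (big_cat_nat (n := K)) ?(ltnW KH) //= mulnDr leq_add //.
  rewrite -mulnn -mulnA leq_mul2l; apply/orP; right.
  apply: leq_trans (_ : \sum_(0 <= g < K) (p.-1)./2 <= _)%N.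
    by apply: leq_sum => g _; exact: card_gcd_pairs_roots.
  by rewrite sum_nat_const_nat subn0.
(* The index [i] stands for the gcd [i + 1], so this tail is that of the gcds above [K], and [H^2]
   times the sum of their inverse squares is at most [H^2 / K]. *)
rewrite -(ler_nat rat) natrM natr_sum mulrC -ler_pdivlMr ?ltr0n // natrX.
apply: le_trans (_ : \sum_(K <= i < H) H%:R ^+ 2 * (i.+1%:R ^+ 2)^-1 <= _).
  apply: ler_sum => g _; rewrite ler_pdivlMr ?exprn_gt0 ?ltr0n //.
  rewrite -natrX -natrM -natrX ler_nat.
  apply: leq_trans (_ : (H %/ g.+1) ^ 2 * g.+1 ^ 2 <= _)%N.
    by rewrite leq_mul2r card_gcd_pairs_range ?orbT.
  by rewrite -expnMn leq_exp2r // leq_trunc_div.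
by rewrite -mulr_sumr ler_wpM2l ?exprn_ge0 ?ler0n // sum_inv_sqr_le ?(ltnW KH).
Qed.
End Energy.

(** * Bilinear character sums *)

(** Cauchy-Schwarz against the constant 1, from Lagrange's identity. Realness is assumed because the
    lemma is applied in [algC]. *)
Lemma sqr_sum_le (R : numFieldType) (I : finType) (A : {set I}) (t : I -> R) :
  (forall i, i \in A -> t i \is Num.real) ->
  (\sum_(i in A) t i) ^+ 2 <= #|A|%:R * \sum_(i in A) t i ^+ 2.
Proof.
move=> tR; rewrite -(ler_pM2l (ltr0n R 2)) -subr_ge0.
suff <- : \sum_(i in A) \sum_(j in A) (t i - t j) ^+ 2 =
    2%:R * (#|A|%:R * \sum_(i in A) t i ^+ 2) - 2%:R * (\sum_(i in A) t i) ^+ 2.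
  by apply: sumr_ge0 => i iA; apply: sumr_ge0 => j jA; rewrite real_exprn_even_ge0 ?rpredB ?tR.
transitivity (\sum_(i in A) (t i ^+ 2 *+ #|A| - t i * (\sum_(j in A) t j) *+ 2 + \sum_(j in A) t j ^+ 2)).
  apply: eq_bigr => i _; under eq_bigr => j _ do rewrite sqrrB.
  by rewrite big_split sumrB /= sumr_const mulr_sumr -sumrMnl.
by rewrite big_split sumrB /= sumr_const !sumrMnl -mulr_suml; ring.
Qed.

Section Characters.
Variables (F : finFieldType) (chi : F -> algC).
Hypothesis chi0 : chi 0 = 0.
Hypothesis chiM : {morph chi : x y / x * y}.
Hypothesis chi_norm : forall x, x != 0 -> `|chi x| = 1.
Hypothesis chi_sum : \sum_x chi x = 0.

Lemma char_conj x : (chi x)^* = chi x^-1.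
Proof.
have [->|x0] := eqVneq x 0; first by rewrite invr0 chi0 conjC0.
have cx0 : chi x != 0 by rewrite -normr_gt0 chi_norm.
have c1 : chi 1 = 1.
  by apply: (mulfI cx0); rewrite -chiM !mulr1.
apply: (mulfI cx0); rewrite -chiM divff // c1.
by rewrite -normCK chi_norm ?expr1n.
Qed.

(** After translating by [b'], each [x != 0] contributes [chi (1 + (b - b') / x)]. If [b != b'], the
    argument runs over everything except 1, and the full sum of [chi] vanishes, which leaves
    [- chi 1]. *)
Lemma char_corr (b b' : F) :
  \sum_x chi (x + b) * (chi (x + b'))^* = (b == b')%:R * #|F|%:R - 1.
Proof.
have c1 : chi 1 = 1.
  have cx0 : chi 1 != 0 by rewrite -normr_gt0 chi_norm ?oner_neq0.
  by apply: (mulfI cx0); rewrite -chiM !mulr1.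
rewrite (reindex_inj (addIr (- b'))) /=.
under eq_bigr => x _ do rewrite addrNK -addrA [- b' + b]addrC.
rewrite (bigD1 0) //= chi0 conjC0 mulr0 add0r.
under eq_bigr => x x0 do rewrite char_conj -chiM mulrDl divff //.
case: eqVneq => [->|bb'].
  under eq_bigr => x _ do rewrite subrr mul0r addr0 c1.
  have := cardC1 (0 : F); rewrite sumr_const mul1r => ->.
  by rewrite -subn1 natrB ?(ltnW (finNzRing_gt1 F)).
have d0 : b - b' != 0 by rewrite subr_eq0.
rewrite mul0r sub0r.
rewrite (reindex (fun y => (b - b') / y)) /=; last first.
  exists (fun y => (b - b') / y) => y _ /=; rewrite invf_div mulrCA divff ?mulr1 //.
rewrite (eq_big (fun y => y != 0) (fun y => chi (1 + y))); first last.
- by move=> y _; rewrite invf_div mulrCA divff ?mulr1.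
- by move=> y; rewrite mulf_eq0 negb_or d0 invr_eq0.
apply/eqP; rewrite -addr_eq0 -[X in _ + X]c1 -[X in chi X]addr0 addrC.
by rewrite -(bigD1 0 (P := xpredT)) //= -(reindex_inj (addrI 1) (F:=chi) (P:=xpredT)) chi_sum.
Qed.

(** Cauchy-Schwarz in [a], then extension of [a] to all of [F]. Once the square is expanded,
    [char_corr] leaves [#|F|] for each diagonal pair; the remaining -1 terms are dropped. *)
Lemma char_bilinear (A B : {set F}) :
  `|\sum_(a in A) \sum_(b in B) chi (a + b)| ^+ 2 <= #|F|%:R * #|A|%:R * #|B|%:R.
Proof.
have Rn (z : algC) : `|z| \is Num.real by rewrite normr_real.
apply: le_trans (_ : (\sum_(a in A) `|\sum_(b in B) chi (a + b)|) ^+ 2 <= _).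
  by rewrite lerXn2r ?nnegrE ?ler_norm_sum ?sumr_ge0 // => *; rewrite normr_ge0.
apply: le_trans (sqr_sum_le _) _ => //.
rewrite [_%:R * #|A|%:R]mulrC -mulrA ler_wpM2l ?ler0n //.
apply: le_trans (_ : \sum_x `|\sum_(b in B) chi (x + b)| ^+ 2 <= _).
  rewrite [leRHS](bigID (mem A)) /= lerDl sumr_ge0 // => *; exact: exprn_ge0.
under eq_bigr => x _ do rewrite normCK rmorph_sum big_distrlr /=.
rewrite exchange_big /=.
under eq_bigr => b _ do rewrite exchange_big /=.
under eq_bigr => b _ do under eq_bigr => b' _ do rewrite char_corr.
under eq_bigr => b bB do rewrite sumrB (bigD1 b) //= eqxx mul1r.
have -> : #|F|%:R * #|B|%:R = \sum_(b in B) #|F|%:R :> algC by rewrite sumr_const mulr_natr.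
apply: ler_sum => b bB.
rewrite big1 ?addr0 ?gerBl ?sumr_ge0 //.
by move=> b' /andP[_ /negbTE nb]; rewrite eq_sym nb mul0r.
Qed.
End Characters.

(** * Fourier expansion of coprimality to [n] *)

Lemma sum_prim_root_exp (C : fieldType) (n : nat) (z : C) (j : nat) :
  n.-primitive_root z ->
  \sum_(i < n) z ^+ (j * i) = (n %| j)%N%:R * n%:R.
Proof.
move=> prim_z; under eq_bigr do rewrite exprM.
rewrite (prim_order_dvd prim_z).
have [->|zj1] := eqVneq (z ^+ j) 1.
  under eq_bigr do rewrite expr1n.
  by rewrite sumr_const card_ord mul1r.
rewrite mul0r; apply: (mulfI (_ : z ^+ j - 1 != 0)); first by rewrite subr_eq0.
by rewrite -subrX1 mulr0 -exprM mulnC exprM (prim_expr_order prim_z) expr1n subrr.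
Qed.

Lemma coprime_all_primes (n i : nat) : (0 < n)%N ->
  coprime i n = all (fun q => ~~ (q %| i)%N) (primes n).
Proof.
move=> n0; apply/idP/allP => [co q|H].
  rewrite mem_primes => /and3P[prq _ qn]; apply/negP => qi.
  have : (q %| gcdn i n)%N by rewrite dvdn_gcd qi qn.
  by rewrite (eqP co) dvdn1 => /eqP q1; rewrite q1 in prq.
apply/negPn/negP => nco; have g1 : (1 < gcdn i n)%N.
  by rewrite ltn_neqAle eq_sym nco gcdn_gt0 n0 orbT.
have := H (pdiv (gcdn i n)); rewrite mem_primes pdiv_prime // n0.
rewrite (dvdn_trans (pdiv_dvd _) (dvdn_gcdr _ _)) => /(_ isT).
by rewrite (dvdn_trans (pdiv_dvd _) (dvdn_gcdl _ _)).
Qed.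

Lemma totient_prod (R : numFieldType) (n : nat) : (0 < n)%N ->
  \prod_(q <- primes n) (1 - q%:R^-1) = (totient n)%:R / n%:R :> R.
Proof.
move=> n0; rewrite totientE // [in X in _ / X](prod_prime_decomp n0).
rewrite prime_decompE big_map /= !natr_prod -prodf_div !big_seq.
apply: eq_bigr => q; rewrite mem_primes => /and3P[prq _ qn].
have : (0 < logn q n)%N by rewrite logn_gt0 mem_primes prq n0 qn.
case: (logn q n) => // k _ /=; rewrite expnS !natrM -mulrA -subn1 natrB ?prime_gt0 //.
have q0 : q%:R != 0 :> R by rewrite pnatr_eq0 -lt0n prime_gt0.
have qk0 : (q ^ k)%:R != 0 :> R by rewrite pnatr_eq0 -lt0n expn_gt0 prime_gt0.
by field; rewrite q0 qk0.
Qed.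

Section Expansion.
Variables (n : nat) (z : algC).
Hypothesis prim_z : n.-primitive_root z.

(** A Fourier expansion modulo [n] with a bound on the l1 norm of its coefficients. Frequencies may
    repeat in the list, so a product is simply the list of all pairs, with no collecting of
    terms. *)
Definition expands (h : nat -> algC) (c : algC) :=
  exists2 s : seq (algC * nat),
    forall i, h i = \sum_(t <- s) t.1 * z ^+ (t.2 * i)
    & \sum_(t <- s) `|t.1| <= c.

Lemma expands1 : expands (fun=> 1) 1.
Proof.
exists [:: (1, 0%N)] => [i|]; rewrite big_seq1 /= ?normr1 //.
by rewrite mul0n mul1r.
Qed.

Lemma expandsM h1 h2 c1 c2 :
  expands h1 c1 -> expands h2 c2 -> expands (fun i => h1 i * h2 i) (c1 * c2).
Proof.
move=> [s1 e1 b1] [s2 e2 b2].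
exists [seq (t1.1 * t2.1, (t1.2 + t2.2)%N) | t1 <- s1, t2 <- s2] => [i|].
  rewrite e1 e2 big_distrlr big_allpairs_dep /=.
  by apply: eq_bigr => t1 _; apply: eq_bigr => t2 _; rewrite mulnDl exprD mulrACA.
rewrite big_allpairs_dep /=.
under eq_bigr => t1 _ do under eq_bigr => t2 _ do rewrite normrM.
rewrite -big_distrlr ler_pM ?sumr_ge0 //=.
Qed.

(** The indicator is 1 minus the mean of the [q]-th roots of unity to the power [i]: the constant
    coefficient is [1 - 1/q], and [q - 1] others have absolute value [1/q]. *)
Lemma expands_ndvd q : prime q -> (q %| n)%N ->
  expands (fun i => (~~ (q %| i)%N)%:R) (2%:R * (1 - q%:R^-1)).
Proof.
move=> prq qn; have q0 := prime_gt0 prq.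
have qR0 : q%:R != 0 :> algC by rewrite pnatr_eq0 -lt0n.
have prim_v : q.-primitive_root (z ^+ (n %/ q)).
  have n0 := prim_order_gt0 prim_z.
  have := exp_prim_root prim_z (n %/ q); rewrite (gcdn_idPl _) ?divn_dvd //.
    by rewrite divnA // mulKn.
  by rewrite dvdn_div.
exists ((1 - q%:R^-1, 0%N) :: [seq (- q%:R^-1, (n %/ q * k)%N) | k <- iota 1 q.-1]).
  move=> i; rewrite big_cons mul0n expr0 mulr1 /= big_map /=.
  under eq_bigr => k _ do rewrite -mulnA exprM.
  rewrite -mulr_sumr.
  have -> : \sum_(k <- iota 1 q.-1) (z ^+ (n %/ q)) ^+ (k * i)
      = \sum_(k < q) (z ^+ (n %/ q)) ^+ (i * k) - 1.
    rewrite -(big_mkord xpredT (fun k => (z ^+ (n %/ q)) ^+ (i * k))).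
    rewrite big_ltn // muln0 expr0 addrC addKr /index_iota subn1.
    by apply: eq_bigr => k _; rewrite mulnC.
  rewrite sum_prim_root_exp //.
  by case: (q %| i)%N; rewrite /= ?mulr1n ?mulr0n; field.
rewrite big_cons big_map /= normrN normrV ?unitfE // normr_nat.
rewrite big_const_seq count_predT size_iota iter_addr addr0.
have q1 : q%:R^-1 <= 1 :> algC by rewrite invf_le1 ?ler1n ?ltr0n.
rewrite ger0_norm ?subr_ge0 // -[X in _ + X <= _]mulr_natl -subn1 natrB //.
by rewrite -subr_ge0 le_eqVlt; apply/orP; left; apply/eqP; field.
Qed.

Lemma expands_coprime :
  expands (fun i => (coprime i n)%:R)
    (2%:R ^+ size (primes n) * ((totient n)%:R / n%:R)).
Proof.
have n0 := prim_order_gt0 prim_z.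
rewrite -totient_prod //.
suff [s e b] : expands (fun i => (all (fun q => ~~ (q %| i)%N) (primes n))%:R)
    (2%:R ^+ size (primes n) * \prod_(q <- primes n) (1 - q%:R^-1)).
  by exists s => // i; rewrite coprime_all_primes.
have : all (fun q => prime q && (q %| n)%N) (primes n).
  by apply/allP => q; rewrite mem_primes => /and3P[-> _ ->].
elim: (primes n) => [|q s IH] /=.
  move=> _; rewrite big_nil mulr1; exact: expands1.
case/andP => /andP[prq qn] /IH es; rewrite big_cons exprS mulrACA.
have [s' e b] := expandsM (expands_ndvd prq qn) es.
by exists s' => // i; rewrite -e -natrM mulnb.
Qed.

(** Averaging over a period kills every frequency not divisible by [n]. *)
Lemma expands_mean s h :
  (forall i, h i = \sum_(t <- s) t.1 * z ^+ (t.2 * i)) ->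
  \sum_(t <- s | (n %| t.2)%N) t.1 = (\sum_(i < n) h i) / n%:R.
Proof.
move=> e; have n0 := prim_order_gt0 prim_z.
under [in RHS]eq_bigr do rewrite e.
rewrite exchange_big /= big_mkcond mulr_suml; apply: eq_bigr => t _.
rewrite -mulr_sumr sum_prim_root_exp //.
have nR : n%:R != 0 :> algC by rewrite pnatr_eq0 -lt0n.
by case: ifP => _; rewrite ?mul0r ?mulr0 ?mul0r // mul1r mulfK.
Qed.
End Expansion.

(** * Multiplicative characters of a finite field and primitive elements *)

Lemma finField_prim_root (F : finFieldType) :
  exists g : F, #|F|.-1.-primitive_root g.
Proof.
have F1 := finNzRing_gt1 F.
have n0 : (0 < #|F|.-1)%N by rewrite -ltnS prednK // ltnW.
pose s := enum (predC1 (0 : F)).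
have /hasP[g _ gP] : has #|F|.-1.-primitive_root s.
  apply: has_prim_root => //; last by rewrite -cardE cardC1.
  - apply/allP => x; rewrite mem_enum inE => x0; apply/unity_rootP.
    by apply: (mulfI x0); rewrite mulr1 -exprS prednK ?expf_card // ltnW.
  - exact: enum_uniq.
by exists g.
Qed.

Section PrimitiveElements.
Variables (F : finFieldType) (g : F).
Let n := #|F|.-1.
Hypothesis prim_g : n.-primitive_root g.

(** At 0 the search fails and returns the junk value [n], which is why [mchar] treats 0
    separately. *)
Definition dlog (x : F) : nat := find (fun i => g ^+ i == x) (iota 0 n).

Lemma dlogK x : x != 0 -> g ^+ dlog x = x.
Proof.
move=> x0; have F1 := finNzRing_gt1 F.
have xn : x ^+ n = 1.
  by apply: (mulfI x0); rewrite mulr1 -exprS prednK ?expf_card // ltnW.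
have [i xi] := prim_rootP prim_g xn.
have hs : has (fun i => g ^+ i == x) (iota 0 n).
  by apply/hasP; exists (val i); rewrite ?mem_iota ?xi ?ltn_ord.
have := nth_find 0%N hs; rewrite nth_iota; first by move/eqP.
by rewrite -[X in (_ < X)%N](size_iota 0) -has_find.
Qed.

Lemma g_neq0 : g != 0.
Proof.
apply/eqP => g0; have := prim_expr_order prim_g.
rewrite g0 expr0n eqn0Ngt (prim_order_gt0 prim_g) /= => /eqP.
by rewrite eq_sym oner_eq0.
Qed.

Lemma dlogM x y : x != 0 -> y != 0 -> dlog (x * y) = dlog x + dlog y %[mod n].
Proof.
move=> x0 y0; apply/eqP; rewrite -(eq_prim_root_expr prim_g) exprD !dlogK //.
by rewrite mulf_neq0.
Qed.

Lemma prim_root_dlog x : x != 0 -> n.-primitive_root x = coprime (dlog x) n.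
Proof. by move=> x0; rewrite -{1}(dlogK x0) prim_root_exp_coprime. Qed.

Variable z : algC.
Hypothesis prim_z : n.-primitive_root z.

Definition mchar (j : nat) (x : F) : algC :=
  if x == 0 then 0 else z ^+ (j * dlog x).

Lemma mcharM j : {morph mchar j : x y / x * y}.
Proof.
move=> x y; rewrite /mchar mulf_eq0.
case: eqVneq => [|x0] /=; first by rewrite mul0r.
case: eqVneq => [|y0]; first by rewrite mulr0.
apply/eqP; rewrite -exprD (eq_prim_root_expr prim_z) -mulnDr.
by rewrite -modnMmr dlogM // modnMmr.
Qed.

Lemma mchar_norm j x : x != 0 -> `|mchar j x| = 1.
Proof.
move/negbTE=> x0; rewrite /mchar x0 normrX.
have -> : `|z| = 1; last by rewrite expr1n.
have n0 := prim_order_gt0 prim_z.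
apply/eqP; rewrite -(@pexpr_eq1 _ _ n) ?normr_ge0 //.
by rewrite -normrX (prim_expr_order prim_z) normr1.
Qed.

(** The substitution [x -> g * x] multiplies the sum by [mchar j g], which is not 1. *)
Lemma mchar_sum j : ~~ (n %| j)%N -> \sum_x mchar j x = 0.
Proof.
move=> nj; have mg : mchar j g != 1.
  rewrite /mchar (negbTE g_neq0) -(prim_order_dvd prim_z).
  have d1 : dlog g = 1 %[mod n].
    by apply/eqP; rewrite -(eq_prim_root_expr prim_g) dlogK ?g_neq0.
  by rewrite /dvdn -modnMmr d1 modnMmr muln1.
apply: (mulfI (_ : mchar j g - 1 != 0)); first by rewrite subr_eq0.
rewrite mulr0 mulrBl mul1r mulr_sumr [X in _ - X](reindex_inj (mulfI g_neq0)) /=.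
by rewrite -sumrB big1 // => x _; rewrite mcharM subrr.
Qed.
End PrimitiveElements.

(** An element is primitive when its discrete logarithm is coprime to [n]; this indicator is
    expanded into characters. The trivial ones give the main term [totient n / n * L^2], and each
    other bilinear sum is at most [w * L], where [w] is an integer upper bound for the square root
    of [#|F|]. *)
Lemma prim_root_bilinear (F : finFieldType) (A B : {set F}) (L w : nat) :
  let n := #|F|.-1 in
  {in A & B, forall a b, a + b != 0} -> #|A| = L -> #|B| = L -> (#|F| <= w ^ 2)%N ->
  (totient n * L ^ 2 <= n * (\sum_(a in A) \sum_(b in B) n.-primitive_root (a + b)) +
     totient n * (2 ^ size (primes n)).-1 * w * L)%N.
Proof.
move=> n AB0 cA cB Fw; have [g prim_g] := finField_prim_root F.
have n0 := prim_order_gt0 prim_g.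
have [z prim_z] := C_prim_root_exists n0.
have nR : 0 < n%:R :> algC by rewrite ltr0n.
set r := (totient n)%:R / n%:R : algC.
set S := (\sum_(a in A) \sum_(b in B) _)%N.
have [s e bnd] := expands_coprime prim_z.
have mean : \sum_(t <- s | (n %| t.2)%N) t.1 = r.
  rewrite (expands_mean prim_z e) -natr_sum /r totient_count_coprime big_mkord.
  by congr (_%:R / _); apply: eq_bigr => i _; rewrite coprime_sym.
pose T j := \sum_(a in A) \sum_(b in B) mchar g z j (a + b).
have SE : S%:R = \sum_(t <- s) t.1 * T t.2.
  rewrite natr_sum.
  under eq_bigr => a aA.
    rewrite natr_sum.
    under eq_bigr => b bB.
      rewrite (prim_root_dlog prim_g) ?AB0 // e.
      over.
    rewrite exchange_big /=.
    over.
  rewrite exchange_big; apply: eq_bigr => t _.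
  rewrite mulr_sumr; apply: eq_bigr => a aA.
  rewrite mulr_sumr; apply: eq_bigr => b bB.
  by rewrite /mchar (negbTE (AB0 a b aA bB)).
have T0 j : (n %| j)%N -> T j = (L ^ 2)%:R.
  move=> nj; rewrite /T.
  under eq_bigr => a aA.
    under eq_bigr => b bB.
      have -> : mchar g z j (a + b) = 1.
        rewrite /mchar (negbTE (AB0 a b aA bB)).
        by apply/eqP; rewrite -(prim_order_dvd prim_z) dvdn_mulr.
      over.
    rewrite sumr_const cB.
    over.
  by rewrite sumr_const cA -mulrnA mulnn.
have T1 j : ~~ (n %| j)%N -> `|T j| <= (w * L)%:R.
  move=> nj; rewrite -(@ler_pXn2r _ 2) ?nnegrE ?normr_ge0 ?ler0n //.
  apply: le_trans (char_bilinear _ _ _ _ _ _) _.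
  - by rewrite /mchar eqxx.
  - exact: mcharM.
  - exact: mchar_norm.
  - exact: mchar_sum.
  by rewrite cA cB -!natrM -natrX ler_nat expnMn -mulnA mulnn leq_mul2r Fw orbT.
(* The total norm is at most [2^omega * r], where [omega] is the number of primes dividing [n]. The
   trivial frequencies, whose coefficients sum to [r], already account for at least [r] of it. *)
have nontriv : \sum_(t <- s | ~~ (n %| t.2)%N) `|t.1| <= ((2 ^ size (primes n)).-1)%:R * r.
  rewrite -subn1 natrB ?expn_gt0 // mulrBl mul1r natrX lerBrDl.
  apply: le_trans bnd; rewrite [leRHS](bigID (fun t => n %| t.2)%N) /= lerD2r.
  rewrite -mean; apply: le_trans (ler_norm_sum _ _ _).
  by rewrite real_ler_norm // mean rpredM ?rpredV ?realn.
have main : `|S%:R - r * (L ^ 2)%:R| <= ((2 ^ size (primes n)).-1)%:R * r * (w * L)%:R.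
  rewrite SE (bigID (fun t => n %| t.2)%N) /= -[X in _ - X * _]mean mulr_suml.
  under [X in X + _ - _]eq_bigr => t nt do rewrite T0 //.
  rewrite addrAC subrr add0r; apply: le_trans (ler_norm_sum _ _ _) _.
  apply: le_trans (_ : \sum_(t <- s | ~~ (n %| t.2)%N) `|t.1| * (w * L)%:R <= _).
    by apply: ler_sum => t nt; rewrite normrM ler_wpM2l ?normr_ge0 ?T1.
  by rewrite -mulr_suml ler_wpM2r ?ler0n.
have Rr : r \is Num.real by rewrite ger0_real ?divr_ge0 ?ler0n.
have Rx : S%:R - r * (L ^ 2)%:R \is Num.real.
  by apply: realB; [exact: realn | apply: realM; [exact: Rr | exact: realn]].
move: main; rewrite (real_ler_norml _ Rx) => /andP[main _].
move: main; rewrite lerBrDr addrC lerBlDr.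
rewrite -(ler_pM2l nR) -(ler_nat algC) !natrD !natrM mulrDr.
have -> : n%:R * (r * (L%:R * L%:R)) = (totient n)%:R * (L%:R * L%:R).
  by rewrite /r; field; rewrite gt_eqF.
have -> // : n%:R * (((2 ^ size (primes n)).-1)%:R * r * (w%:R * L%:R)) =
  (totient n)%:R * ((2 ^ size (primes n)).-1)%:R * w%:R * L%:R.
rewrite /r; field; by rewrite gt_eqF.
Qed.

(** * Small primitive roots modulo the square of a prime *)

(** The order of [g] modulo [p^2] is a multiple of [p - 1], divides [p * (p - 1)] and does not
    divide [p - 1]. As [p] is prime, it equals [p * (p - 1)]. *)
Lemma primitive_root_sqr (p g : nat) : prime p ->
  p.-1.-primitive_root (g%:R : 'F_p) -> (g ^ p.-1 != 1 %[mod p ^ 2])%N ->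
  primitive_root (p ^ 2) g.
Proof.
move=> prp prim_g wg; have p1 := prime_gt1 prp; have p0 := prime_gt0 prp.
have p21 : (1 < p ^ 2)%N by rewrite (ltn_exp2l 0).
have n0 := prim_order_gt0 prim_g.
have cog : coprime (p ^ 2) g.
  rewrite coprimeXl // prime_coprime // (dvdn_pcharf (pchar_Fp prp)).
  apply/eqP => g0; have := prim_expr_order prim_g.
  by rewrite g0 expr0n eqn0Ngt n0 /= => /eqP; rewrite eq_sym oner_eq0.
have Ug : (g%:R : 'Z_(p ^ 2)) \is a GRing.unit by rewrite unitZpE.
pose u : {unit 'Z_(p ^ 2)} := FinRing.unit _ Ug.
have uX k : ((u ^+ k)%g == 1%g) = (g ^ k == 1 %[mod p ^ 2])%N.
  rewrite -val_eqE /= FinRing.val_unitX /= -natrX -val_eqE.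
  have -> : val (val (1%g : {unit 'Z_(p ^ 2)})) = (1 %% p ^ 2)%N by rewrite -val_Zp_nat.
  by rewrite /= val_Zp_nat.
have d1 : (p.-1 %| #[u]%g)%N.
  rewrite (prim_order_dvd prim_g) -natrX -[1]/(1%:R) eq_Fp_nat //.
  have := uX #[u]%g; rewrite expg_order eqxx => /esym/eqP.
  by move/(congr1 (modn^~ p)); rewrite /= !modn_dvdm ?dvdn_exp // => ->.
have cU : #|units_Zp (p ^ 2)| = (p.-1 * p)%N.
  by rewrite card_units_Zp ?expn_gt0 ?p0 // totient_pfactor ?expn1.
have d2 : (#[u]%g %| p.-1 * p)%N by rewrite -cU order_dvdG ?inE.
have d3 : ~~ (#[u]%g %| p.-1)%N by rewrite order_dvdn uX.
have ou : #[u]%g = (p.-1 * p)%N.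
  case/dvdnP: d1 => e ee; move: d2 d3; rewrite ee mulnC dvdn_pmul2l //.
  by case/primeP: prp => _ /[apply] /orP[] /eqP ->; rewrite ?muln1 ?dvdnn.
apply/existsP; exists u; rewrite /= eqxx /generator eq_sym eqEcard.
by rewrite cU -ou leqnn andbT; apply/subsetP => x _; rewrite inE.
Qed.

Lemma least_primitive_root_sqr_lt (R : realType) (p : nat) (prp : prime p) (oddp : odd p) n :
  primitive_root (p ^ 2) n -> (n ^ 100 < p ^ 99)%N ->
  (least_primitive_root_sqr prp oddp)%:R < p%:R `^ (99%:R / 100%:R) :> R.
Proof.
move=> prn np; have p1 := prime_gt1 prp.
(* The minimum is taken over positive integers; 0 is excluded because it is not a unit. *)
have n0 : (0 < n)%N.
  case: n prn {np} => // /existsP[u /andP[/eqP u0 _]].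
  have := valP u; rewrite u0 unitZpE ?(ltn_exp2l 0) //.
  by rewrite /coprime gcdn0 => /eqP p2; have := ltn_exp2l 0 2 p1; rewrite p2.
rewrite /least_primitive_root_sqr; case: ex_minnP => m _ /(_ n); rewrite n0 prn => /(_ isT) mn.
apply: le_lt_trans (_ : n%:R < _); first by rewrite ler_nat.
rewrite -(@ltr_pXn2r _ 100) ?nnegrE ?ler0n ?powR_ge0 //.
have -> : (p%:R `^ (99%:R / 100%:R)) ^+ 100 = p%:R ^+ 99 :> R.
  by rewrite -powR_mulrn ?powR_ge0 // -powRrM divfK ?pnatr_eq0 // powR_mulrn.
by rewrite -!natrX ltr_nat.
Qed.

Definition prim_roots_le (p H : nat) : {set 'F_p} :=
  [set x : 'F_p | (x <= H)%N & p.-1.-primitive_root x].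

Section NoSmallRoot.
Variables (p H : nat).
Hypotheses (prp : prime p) (oddp : odd p) (Hp : (H < p)%N).

(** Without a primitive root modulo [p^2] up to [H], each primitive root [a] modulo [p] in this
    range has [a^(p-1) = 1] modulo [p^2]. Also [a^((p-1)/2)] is a square root of 1 other than 1, so
    [card_fermat_le] applies. *)
Lemma card_prim_roots_le K : (0 < K)%N ->
  (forall n, (n <= H)%N -> ~~ primitive_root (p ^ 2) n) ->
  (K * #|prim_roots_le p H| ^ 2 <= K ^ 2 * (p.-1)./2 + H ^ 2)%N.
Proof.
move=> K0 noroot; have p2 := odd_prime_gt2 oddp prp.
apply: (card_fermat_le prp) => //= a; rewrite inE => /andP[aH prim_a].
- rewrite aH andbT lt0n; apply/eqP => a0.
  have := prim_expr_order prim_a; rewrite (_ : a = 0); last exact: val_inj.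
  by rewrite expr0n eqn0Ngt (prim_order_gt0 prim_a) /= => /eqP; rewrite eq_sym oner_eq0.
- have := noroot _ aH; apply: contraNeq => a1; apply: primitive_root_sqr => //.
    by rewrite natr_Zp.
  apply: contra a1 => /eqP a1; rewrite -[X in (_ ^ X)%N](prednK (prime_gt0 prp)) expnS.
  by rewrite -modnMmr a1 modnMmr muln1.
- rewrite natr_Zp; have : (a ^+ (p.-1)./2) ^+ 2 == 1.
    by rewrite -exprM muln2 halfK -subn1 oddB ?oddp ?prime_gt0 //= subn0 subn1 (prim_expr_order prim_a).
  rewrite sqrf_eq1 -(prim_order_dvd prim_a) => /orP[|/eqP //].
  by move/dvdn_leq => /(_ _) ; lia.
Qed.

(** Of the [totient p.-1] primitive roots, at most [p - 1 - H] exceed [H]. *)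
Lemma totient_le_card_prim_roots :
  (totient p.-1 <= #|prim_roots_le p H| + (p.-1 - H))%N.
Proof.
have [g prim_g] := finField_prim_root 'F_p; rewrite card_Fp // in prim_g.
have n0 := prim_order_gt0 prim_g.
have tot : (totient p.-1 <= #|[set x : 'F_p | p.-1.-primitive_root x]|)%N.
  rewrite totient_count_coprime big_mkord -sum1_card.
  have inj : {in [set i : 'I_p.-1 | coprime p.-1 i] &, injective (fun i : 'I_p.-1 => g ^+ i)}.
    move=> i j _ _ /eqP; rewrite (eq_prim_root_expr prim_g) !modn_small //.
    by move/eqP/val_inj.
  rewrite sum1_card; apply: leq_trans (_ : #|[set i : 'I_p.-1 | coprime p.-1 i]| <= _)%N.
    by rewrite -sum1_card [leqRHS]big_mkcond /=; apply: leq_sum => i _; rewrite inE; case: coprime.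
  rewrite -(card_in_imset inj); apply: subset_leq_card.
  apply/subsetP => x /imsetP[i]; rewrite !inE => ci ->.
  by rewrite prim_root_exp_coprime // coprime_sym.
apply: leq_trans tot _.
rewrite -(cardsID [set x : 'F_p | (x <= H)%N]) leq_add //.
  by rewrite subset_leq_card //; apply/subsetP => x; rewrite !inE andbC.
apply: leq_trans (_ : size (iota H.+1 (p.-1 - H)) <= _)%N; last by rewrite size_iota.
rewrite cardE -(size_map val); apply: uniq_leq_size.
  by rewrite map_inj_uniq ?enum_uniq //; exact: val_inj.
move=> y /mapP[x]; rewrite mem_enum !inE => /andP[xH _] ->; rewrite mem_iota ltnNge xH /=.
have := ltn_ord x; rewrite [X in (_ < X)%N]Fp_cast // => xp; move: xH xp Hp; rewrite -ltnNge; lia.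
Qed.

(** Take [A = B = {1, ..., L}]: sums stay in [2..H], so there is no wraparound modulo [p]. For fixed
    [a] the map [b -> a + b] is injective, so each [a] sees at most [#|prim_roots_le p H|] primitive
    sums, and a factor [L] cancels. *)
Lemma prim_roots_le_bilinear (L w : nat) :
  (L.*2 <= H)%N -> (p <= w ^ 2)%N ->
  (totient p.-1 * L <= p.-1 * #|prim_roots_le p H| +
     totient p.-1 * (2 ^ size (primes p.-1)).-1 * w)%N.
Proof.
move=> LH pw; have [->|L0] := posnP L; first by rewrite muln0.
pose f (i : 'I_L) : 'F_p := i.+1%:R.
have inj : injective f.
  move=> i j /eqP; rewrite eq_Fp_nat // !modn_small; last first.
  - by have := ltn_ord i; lia.
  - by have := ltn_ord j; lia.
  by move/eqP => [] /val_inj.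
pose A := f @: setT.
have cA : #|A| = L by rewrite card_imset // cardsT card_ord.
have val_sum i j : val (f i + f j) = (i.+1 + j.+1)%N.
  rewrite /f -natrD; transitivity ((i.+1 + j.+1) %% p)%N; first exact: val_Fp_nat.
  rewrite modn_small //.
  by have := ltn_ord i; have := ltn_ord j; lia.
have A0 : {in A & A, forall a b, a + b != 0}.
  move=> a b /imsetP[i _ ->] /imsetP[j _ ->]; rewrite -val_eqE val_sum //.
have := prim_root_bilinear A0 cA cA; rewrite card_Fp // => /(_ _ pw) main.
rewrite -(leq_pmul2r L0) -mulnA mulnn; apply: leq_trans main _.
rewrite mulnDl leq_add2r -mulnA leq_mul2l; apply/orP; right.
rewrite mulnC -[X in (_ <= X * _)%N]cA -sum_nat_const; apply: leq_sum => a aA.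
apply: leq_trans (_ : #|[set b in A | p.-1.-primitive_root (a + b)]| <= _)%N.
  rewrite -sum1_card big_mkcond [leqRHS]big_mkcond; apply: leq_sum => b _.
  by rewrite inE; case: (b \in A) => //=; case: ifP => // ->.
rewrite -(card_imset _ (addrI a)) subset_leq_card //; apply/subsetP => y /imsetP[b].
rewrite inE => /andP[/imsetP[j _ ->] prim_ab ->]; rewrite inE prim_ab andbT.
case/imsetP: aA => i _ ->; rewrite val_sum.
by have := ltn_ord i; have := ltn_ord j; lia.
Qed.
End NoSmallRoot.

(** * Products over prime divisors *)

Section PrimeProducts.
Variable R : realFieldType.

(** A product over primes is largest when it takes exactly the factors above 1, and [ps] is to list
    their primes. *)
Lemma prod_primes_le (f : nat -> R) (s ps : seq nat) :
  uniq s -> uniq ps -> all prime s -> (forall q, 0 <= f q) ->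
  {in ps, forall q, 1 <= f q} -> (forall q, prime q -> q \notin ps -> f q <= 1) ->
  \prod_(q <- s) f q <= \prod_(q <- ps) f q.
Proof.
move=> us ups /allP prs f0 f1 f2.
rewrite (bigID (mem ps)) [leRHS](bigID (mem s)) /=.
have -> : \prod_(q <- s | q \in ps) f q = \prod_(q <- ps | q \in s) f q.
  rewrite -!(big_filter _ (fun q => q \in _)); apply: perm_big.
  by apply: uniq_perm; rewrite ?filter_uniq // => q; rewrite !mem_filter andbC.
rewrite ler_wpM2l ?prodr_ge0 // (@le_trans _ _ 1) //.
  rewrite big_seq_cond; apply: prodr_ile1 => q /andP[qs qps].
  by rewrite f0 f2 ?prs.
rewrite big_seq_cond -[leLHS](@big1_eq _ _ *%R _ ps (fun q => (q \in ps) && (q \notin s))).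
by apply: ler_prod => q /andP[qps _]; rewrite ler01 f1.
Qed.

Lemma prod_primes_dvd (n : nat) : (0 < n)%N -> (\prod_(q <- primes n) q <= n)%N.
Proof.
move=> n0; rewrite [leqRHS](prod_prime_decomp n0) prime_decompE big_map /= !big_seq.
apply: leq_prod => q; rewrite mem_primes => /and3P[prq _ qn].
by rewrite -{1}(expn1 q) leq_exp2l ?prime_gt1 // logn_gt0 mem_primes prq n0.
Qed.

Lemma all_prime_primes n : all prime (primes n).
Proof. by apply/allP => q; rewrite mem_primes => /and3P[]. Qed.

(** Write [16^omega] as the product of the [16 / q] times the product of the [q]. Only primes up to
    13 have [16 / q > 1], and [16^6 / 30030 < 559]. *)
Lemma exp16_omega_le (n : nat) : (0 < n)%N ->
  16%:R ^+ size (primes n) <= 559%:R * n%:R :> R.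
Proof.
move=> n0; pose f (q : nat) : R := 16%:R / q%:R.
have H : \prod_(q <- primes n) f q <= \prod_(q <- [:: 2; 3; 5; 7; 11; 13]%N) f q.
  apply: prod_primes_le; rewrite ?primes_uniq ?all_prime_primes //.
  - by move=> q; rewrite divr_ge0.
  - move=> q; rewrite !inE /f; repeat case/orP; move=> /eqP ->; lra.
  move=> q prq qps; rewrite /f ler_pdivrMr ?ltr0n ?prime_gt0 // mul1r ler_nat.
  rewrite leqNgt; apply: contra qps => q16.
  by move: prq; do 16!(case: q q16 => [|q] q16 //).
have -> : 16%:R ^+ size (primes n) = \prod_(q <- primes n) f q * (\prod_(q <- primes n) q)%:R.
  rewrite natr_prod -big_split /= big_seq (eq_bigr (fun=> 16%:R)); last first.
    by move=> q; rewrite mem_primes /f => /and3P[/prime_gt0 q0 _ _]; rewrite divfK // pnatr_eq0 -lt0n.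
  by rewrite -big_seq big_const_seq count_predT iter_mulr_1.
rewrite ler_pM ?prodr_ge0 // => [q _||]; first by rewrite divr_ge0.
  apply: le_trans H _; rewrite !big_cons big_nil /f; lra.
by rewrite ler_nat prod_primes_dvd.
Qed.

(** The factor [(1 - 1/q)^(-20) / q] exceeds 1 only for [q = 2, 3, 5, 7], whose product is 210, and
    [210 / totient 210 = 35/8]. *)
Lemma totient_ratio_le (n : nat) : (0 < n)%N ->
  (n%:R / (totient n)%:R) ^+ 20 <= (35%:R / 8%:R) ^+ 20 / 210%:R * n%:R :> R.
Proof.
move=> n0; pose f (q : nat) : R := (1 - q%:R^-1) ^- 20 / q%:R.
have f0 q : 0 <= f q.
  rewrite divr_ge0 // invr_ge0 exprn_even_ge0 //.
have f_eq (q : nat) : f q.+2 = (q.+2%:R / q.+1%:R) ^+ 20 / q.+2%:R.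
  rewrite /f -exprVn; congr (_ ^+ 20 / _); rewrite -[q.+2%:R]natr1.
  by have q0 : 0 < q.+1%:R :> R := ltr0Sn _ _; field; lra.
have H : \prod_(q <- primes n) f q <= \prod_(q <- [:: 2; 3; 5; 7]%N) f q.
  apply: prod_primes_le; rewrite ?primes_uniq ?all_prime_primes //.
  - by move=> q; rewrite !inE; repeat case/orP; move=> /eqP ->; rewrite f_eq; lra.
  move=> q prq qps; rewrite /f.
  have q11 : (11 <= q)%N.
    rewrite leqNgt; apply: contra qps => q16.
    by move: prq; do 11!(case: q q16 => [|q] q16 //).
  have q0 : 0 < q%:R :> R by rewrite ltr0n (leq_trans _ q11).
  have q1 : 11%:R <= q%:R :> R by rewrite ler_nat.
  have qi : q%:R^-1 <= 11%:R^-1 :> R by rewrite lef_pV2 // posrE ?ltr0n.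
  rewrite ler_pdivrMr // mul1r (le_trans _ q1) // -exprVn.
  apply: le_trans (_ : (11%:R / 10%:R) ^+ 20 <= _); last by lra.
  rewrite lerXn2r ?nnegrE ?invr_ge0; [by []|lra|lra|].
  by rewrite -[leRHS]invrK lef_pV2 ?posrE ?invr_gt0; lra.
have <- : \prod_(q <- primes n) (1 - q%:R^-1)^-1 = n%:R / (totient n)%:R :> R.
  by rewrite prodfV totient_prod // invf_div.
have -> : (\prod_(q <- primes n) (1 - q%:R^-1)^-1) ^+ 20
    = \prod_(q <- primes n) f q * (\prod_(q <- primes n) q)%:R.
  rewrite natr_prod -big_split /= -prodrXl !big_seq; apply: eq_bigr => q.
  rewrite mem_primes /f => /and3P[/prime_gt0 q0 _ _].
  by rewrite exprVn divfK // pnatr_eq0 -lt0n.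
rewrite ler_pM ?prodr_ge0 //; last by rewrite ler_nat prod_primes_dvd.
apply: le_trans H _; rewrite !big_cons big_nil !f_eq; lra.
Qed.

(* Every prime above [lo] and up to the last element of [ps] occurs in [ps]. *)
Fixpoint all_primes_from (lo : nat) (ps : seq nat) : bool :=
  if ps is p :: ps' then
    [&& (1 < p)%N, all (fun m => ~~ prime m) (iota lo.+1 (p - lo.+1)) & all_primes_from p ps']
  else true.

Lemma all_primes_from_le lo p ps q :
  all_primes_from lo (p :: ps) -> prime q -> (lo < q)%N -> (p <= q)%N.
Proof.
move=> /= /and3P[_ /allP H _] prq loq; rewrite leqNgt; apply/negP => qp.
by move: (H q); rewrite mem_iota prq loq /= => /(_ _); lia.
Qed.

Lemma path_ltnW (lo lo' : nat) s : (lo' <= lo)%N -> path ltn lo s -> path ltn lo' s.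
Proof. by case: s => //= x s le /andP[lx ->]; rewrite (leq_ltn_trans le). Qed.

Lemma prod_primes_from_le lo ps s :
  all_primes_from lo ps -> path ltn lo s -> all prime s -> (size ps <= size s)%N ->
  (\prod_(p <- ps) p <= \prod_(q <- s) q)%N.
Proof.
elim: ps lo s => [|p ps IH] lo s; first by move=> _ _ /allP prs _; rewrite big_nil big_seq prodn_cond_gt0 // => q /prs/prime_gt0.
case: s => [|q s] // H /= /andP[loq pth] /andP[prq prs] sz.
have pq := all_primes_from_le H prq loq; move: H => /= /and3P[_ _ H].
by rewrite !big_cons leq_mul // (IH p) // (path_ltnW pq).
Qed.

Lemma prod_sub_inv_primes_from_le lo ps s :
  all_primes_from lo ps -> path ltn lo s -> all prime s -> (size s <= size ps)%N ->
  \prod_(p <- ps) (1 - p%:R^-1) <= \prod_(q <- s) (1 - q%:R^-1) :> R.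
Proof.
have ge0 q : 0 <= 1 - q%:R^-1 :> R.
  case: q => [|q]; first by rewrite invr0 subr0.
  by rewrite subr_ge0 invf_le1 ?ltr0n // ler1n.
have le1 q : 1 - q%:R^-1 <= 1 :> R by rewrite gerBl invr_ge0 ler0n.
elim: ps lo s => [|p ps IH] lo s; first by case: s.
case: s => [|q s] H pth prs sz.
  by rewrite big_nil prodr_ile1 // => i _; rewrite ge0 le1.
move: pth prs sz => /= /andP[loq pth] /andP[prq prs] sz.
have pq := all_primes_from_le H prq loq; move: H => /= /and3P[p1 _ H].
rewrite !big_cons ler_pM ?prodr_ge0 //.
  by rewrite lerD2l lerN2 lef_pV2 ?posrE ?ltr0n ?ler_nat // ?(ltnW p1) ?prime_gt0.
by rewrite (IH p) // (path_ltnW pq).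
Qed.

(** Below the product of the first [k + 1] primes, [n] has at most [k] prime divisors. In increasing
    order they are at least the first [k] primes, term by term. *)
Lemma totient_ratio_ge ps p n : all_primes_from 0 (rcons ps p) -> (0 < n)%N ->
  (n%:R < \prod_(q <- rcons ps p) q%:R :> R) ->
  \prod_(q <- ps) (1 - q%:R^-1) <= (totient n)%:R / n%:R :> R.
Proof.
move=> H n0 small; rewrite -totient_prod //.
have pth : path ltn 0 (primes n).
  have := sorted_primes n; have := all_prime_primes n.
  by case: (primes n) => //= q s /andP[/prime_gt0 -> _] ->.
have szn : (size (primes n) <= size ps)%N.
  rewrite leqNgt; apply/negP => sz; move: small; apply/negP; rewrite -leNgt -natr_prod ler_nat.
  apply: leq_trans (prod_primes_dvd n0); apply: prod_primes_from_le H pth (all_prime_primes n) _.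
  by rewrite size_rcons.
apply: (prod_sub_inv_primes_from_le _ pth (all_prime_primes n) szn).
suff : forall lo, all_primes_from lo (rcons ps p) -> all_primes_from lo ps by exact.
by elim: (ps) => [|q qs IH] //= lo /and3P[-> -> /IH ->].
Qed.
End PrimeProducts.

(** * The three ranges of primes *)

(** The bound [n < p^0.99] with the real exponent cleared. *)
Definition small_root (p : nat) :=
  exists2 n, primitive_root (p ^ 2) n & (n ^ 100 < p ^ 99)%N.

(** Here [theta^100 * hi <= 1] makes [theta * p] smaller than [p^0.99]. If no root lies up to [H],
    the integer part of [theta * p], counting gives at least [eps * p] primitive roots modulo [p] up
    to [H], against the upper bound from [card_prim_roots_le]. *)
Lemma small_root_count (R : archiRealFieldType) (p : nat) (lo hi theta rho eps : R) (K : nat) :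
  prime p -> odd p -> lo <= p%:R < hi ->
  0 < lo -> 0 < eps -> 0 < theta < 1 -> 0 < K%:R :> R ->
  theta ^+ 100 * hi <= 1 ->
  rho <= (totient p.-1)%:R / p.-1%:R -> rho <= 1 ->
  1 <= (rho - 1 + theta - eps) * lo ->
  K%:R / 2%:R < (eps ^+ 2 - theta ^+ 2 / K%:R) * lo ->
  small_root p.
Proof.
move=> prp oddp /andP[lop phi] lo0 eps0 /andP[th0 th1] K0 th100 rhop rho1 Heps HK.
have p0 : 0 < p%:R :> R by apply: lt_le_trans lop.
have thp0 : 0 <= theta * p%:R by rewrite mulr_ge0 // ltW.
pose H := Num.truncn (theta * p%:R).
have /andP[Hle Hgt] : H%:R <= theta * p%:R < H.+1%:R by exact: truncn_itv.
have Hp : (H < p)%N.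
  rewrite -(ltr_nat R); apply: le_lt_trans Hle _; by rewrite gtr_pMl.
have [/existsP[i rt]|noroot] := boolP [exists i : 'I_H.+1, primitive_root (p ^ 2) i].
  exists i => //; rewrite -(ltr_nat R) !natrX.
  apply: le_lt_trans (_ : (theta * p%:R) ^+ 100 < _).
    rewrite lerXn2r ?nnegrE ?ler0n //; apply: le_trans Hle.
    by rewrite ler_nat -ltnS ltn_ord.
  rewrite exprMn [p%:R ^+ 100]exprS mulrA gtr_pMl ?exprn_gt0 //.
  by apply: lt_le_trans th100; rewrite ltr_pM2l ?exprn_gt0.
clear th100; have {}noroot n : (n <= H)%N -> ~~ primitive_root (p ^ 2) n.
  move=> nH; move: noroot; rewrite negb_exists => /forallP/(_ (inord n)).
  by rewrite inordK.
have Kn0 : (0 < K)%N by rewrite -(ltr0n R).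
have := card_prim_roots_le prp oddp Hp Kn0 noroot.
have := totient_le_card_prim_roots prp oddp Hp.
set s := #|_|; rewrite -!(ler_nat R) !natrD !natrM -!expr2 => Hs Hcard.
exfalso.
have p1 : p.-1%:R = p%:R - 1 :> R by rewrite -subn1 natrB ?prime_gt0.
have pH : (p.-1 - H)%:R = p%:R - 1 - H%:R :> R.
  by rewrite natrB ?p1 // -ltnS prednK ?prime_gt0.
have half : (p.-1)./2%:R <= p%:R / 2%:R :> R.
  rewrite ler_pdivlMr // -natrM ler_nat muln2.
  by apply: leq_trans (leq_pred p); rewrite -[leqRHS]odd_double_half leq_addl.
have p1gt0 : 0 < p.-1%:R :> R by rewrite ltr0n -subn1 subn_gt0 prime_gt1.
have {}rhop : rho * (p%:R - 1) <= (totient p.-1)%:R.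
  by rewrite -p1 -ler_pdivlMr.
rewrite pH in Hs; rewrite -natr1 in Hgt.
have sge : eps * p%:R <= s%:R.
  have : 1 <= (rho - 1 + theta - eps) * p%:R.
    have c0 : 0 < rho - 1 + theta - eps.
      by rewrite -(pmulr_lgt0 _ lo0); apply: lt_le_trans Heps.
    by apply: le_trans Heps _; rewrite ler_pM2l.
  lra.
have H2 : H%:R ^+ 2 <= theta ^+ 2 * p%:R ^+ 2.
  by rewrite -exprMn lerXn2r ?nnegrE ?ler0n.
have s2 : (eps * p%:R) ^+ 2 <= s%:R ^+ 2.
  by rewrite lerXn2r ?nnegrE ?ler0n // mulr_ge0 // ltW.
have Ks : K%:R * (eps * p%:R) ^+ 2 <= K%:R ^+ 2 * (p%:R / 2%:R) + theta ^+ 2 * p%:R ^+ 2.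
  apply: le_trans (_ : K%:R * s%:R ^+ 2 <= _); first by rewrite ler_pM2l.
  apply: le_trans Hcard _; rewrite lerD // ler_wpM2l ?exprn_ge0 // ltW //.
have pos : 0 < eps ^+ 2 - theta ^+ 2 / K%:R.
  rewrite -(pmulr_lgt0 _ lo0); apply: lt_trans HK; by rewrite divr_gt0.
have HKp : K%:R / 2%:R < (eps ^+ 2 - theta ^+ 2 / K%:R) * p%:R.
  by apply: lt_le_trans HK _; rewrite ler_pM2l.
have : K%:R * p%:R * (K%:R / 2%:R) < K%:R * p%:R * ((eps ^+ 2 - theta ^+ 2 / K%:R) * p%:R).
  by rewrite ltr_pM2l ?mulr_gt0.
have -> : K%:R * p%:R * ((eps ^+ 2 - theta ^+ 2 / K%:R) * p%:R) =
  K%:R * (eps * p%:R) ^+ 2 - theta ^+ 2 * p%:R ^+ 2 by field; rewrite gt_eqF.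
lra.
Qed.

(* In each range [lo <= p < hi], [theta] is [hi^(-1/100)] rounded down, [eps] is just
   below [rho - 1 + theta - 1 / lo], and [K] is close to [theta * sqrt (2 lo)], which
   minimises [K p / 2 + (theta p)^2 / K] at [p = lo]. *)
Lemma small_root_mid (R : archiRealFieldType) (p : nat) : prime p -> odd p ->
  9%:R * 10%:R ^+ 3 <= (p%:R : R) < 3%:R * 10%:R ^+ 6 -> small_root p.
Proof.
move=> prp oddp /andP[lop phi].
have n0 : (0 < p.-1)%N by rewrite -subn1 subn_gt0 prime_gt1.
have p1 : p.-1%:R = p%:R - 1 :> R by rewrite -subn1 natrB ?prime_gt0.
(* The cuts [30 * 1001 = 30030] and [510 * 1001 = 510510] are the products of the primes up to 13
   and up to 17; beyond each, [p - 1] may have one more prime factor and [rho] drops to the next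
   value of [totient n / n]. The cuts at [75 * 1001] and 14220 keep [theta] large enough at the
   lower ends. *)
have [p1lt|le1] := ltP (p%:R : R) ((30%:R * 1001%:R)); last first.
  have [p2lt|le2] := ltP (p%:R : R) ((510%:R * 1001%:R)); last first.
    have r : (9216%:R * 10%:R) / (510%:R * 1001%:R) <= (totient p.-1)%:R / p.-1%:R :> R.
      apply: le_trans (@totient_ratio_ge R [:: 2; 3; 5; 7; 11; 13; 17]%N 19 _ _ _ _) => //.
        rewrite !big_cons big_nil; lra.
      by rewrite p1 !big_cons big_nil; lra.
    apply: (@small_root_count R p (510%:R * 1001%:R) (3%:R * 10%:R ^+ 6) (8614%:R / 10000%:R) ((9216%:R * 10%:R) / (510%:R * 1001%:R)) (419%:R / 10000%:R) 870) => //; lra.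
  have r : 5760%:R / (30%:R * 1001%:R) <= (totient p.-1)%:R / p.-1%:R :> R.
    apply: le_trans (@totient_ratio_ge R [:: 2; 3; 5; 7; 11; 13]%N 17 _ _ _ _) => //.
      rewrite !big_cons big_nil; lra.
    by rewrite p1 !big_cons big_nil; lra.
  have [p3lt|le3] := ltP (p%:R : R) ((75%:R * 1001%:R)).
    apply: (@small_root_count R p (30%:R * 1001%:R) (75%:R * 1001%:R) (8938%:R / 10000%:R) (5760%:R / (30%:R * 1001%:R)) (855%:R / 10000%:R) 219) => //; lra.
  apply: (@small_root_count R p (75%:R * 1001%:R) (510%:R * 1001%:R) (8768%:R / 10000%:R) (5760%:R / (30%:R * 1001%:R)) (685%:R / 10000%:R) 340) => //; lra.
have r : 16%:R / 77%:R <= (totient p.-1)%:R / p.-1%:R :> R.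
  apply: le_trans (@totient_ratio_ge R [:: 2; 3; 5; 7; 11]%N 13 _ _ _ _) => //.
    rewrite !big_cons big_nil; lra.
  by rewrite p1 !big_cons big_nil; lra.
have [p3lt|le3] := ltP (p%:R : R) ((1422%:R * 10%:R)).
  apply: (@small_root_count R p (9%:R * 10%:R ^+ 3) (1422%:R * 10%:R) (9088%:R / 10000%:R) (16%:R / 77%:R) (1164%:R / 10000%:R) 122) => //; lra.
apply: (@small_root_count R p (1422%:R * 10%:R) (30%:R * 1001%:R) (9020%:R / 10000%:R) (16%:R / 77%:R) (1097%:R / 10000%:R) 152) => //; lra.
Qed.

(** All quantities are compared as powers of [y = p^(1/100)]: the assumption of no small root bounds
    [L], which is about [y^99 / 2], by multiples of [y^80] and [y^75] and smaller terms. *)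
Lemma small_root_large (R : realType) (p : nat) : prime p -> odd p ->
  3%:R * 10%:R ^+ 6 <= (p%:R : R) -> small_root p.
Proof.
move=> prp oddp lep; set y : R := p%:R `^ (100%:R^-1).
have p0 : 0 < p%:R :> R by rewrite ltr0n prime_gt0.
have y0 : 0 < y by exact: powR_gt0.
have y100 : y ^+ 100 = p%:R.
  by rewrite /y -powR_mulrn ?powR_ge0 // -powRrM mulVf ?pnatr_eq0 // powRr1 // ltW.
(* Because [1.16^100 < 3 * 10^6]. *)
have yge : 116%:R / 100%:R <= y.
  rewrite leNgt; apply/negP => yl.
  have : y ^+ 100 < (116%:R / 100%:R) ^+ 100.
    by rewrite ltrXn2r // ?nnegrE ?ltW // divr_ge0.
  rewrite y100 => /(le_lt_trans lep); apply/negP; rewrite -leNgt; lra.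
clear lep; clearbody y.
have ypow m k (c : R) : c <= (116%:R / 100%:R) ^+ k -> c * y ^+ m <= y ^+ (k + m).
  move=> ck; rewrite exprD ler_pM2r ?exprn_gt0 //; apply: le_trans ck _.
  by rewrite lerXn2r ?nnegrE ?divr_ge0 // ltW.
have ypos k : 0 < y ^+ k by exact: exprn_gt0.
have ynn k : 0 <= y ^+ k by exact: ltW.
have e1 : 167%:R / 10%:R * y ^+ 80 <= y ^+ (19 + 80) by apply: ypow; lra.
have e2 : 2%:R * y ^+ 75 <= y ^+ (5 + 75) by apply: ypow; lra.
have e3 : 1600%:R * y ^+ 25 <= y ^+ (50 + 25) by apply: ypow; lra.
have e4 : 1%:R * y ^+ 0 <= y ^+ (25 + 0) by apply: ypow; lra.
have e5 : 1600%:R * y ^+ 100 <= y ^+ (50 + 100) by apply: ypow; lra.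
have e6 : 134%:R / 100%:R * y ^+ 148 <= y ^+ (2 + 148) by apply: ypow; lra.
rewrite ?[(_ + _)%N]/= in e1 e2 e3 e4 e5 e6; rewrite expr0 in e4.
(* Subtracting 1 keeps [2L] strictly below [y^99], so that every [n <= 2L] satisfies
   [n^100 < p^99]. *)
have [L Lle Lgt] : exists2 L : nat, L.*2%:R <= y ^+ 99 - 1 & y ^+ 99 < L.*2%:R + 3%:R.
  set x := (y ^+ 99 - 1) / 2%:R; have x0 : 0 <= x by have := ypos 80; have := ypos 25; rewrite /x; lra.
  have [Lx xL] := andP (truncn_itv x0); set L := Num.truncn x in Lx xL.
  exists L; rewrite -muln2 natrM; first by rewrite -ler_pdivlMr.
  rewrite -(natr1 L) ltr_pdivrMr // in xL.
  by move: xL; generalize (y ^+ 99) (L%:R : R) => u v; lra.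
have L2y : L.*2%:R < y ^+ 99 by apply: le_lt_trans Lle _; rewrite gtrBl.
set H := L.*2 in L2y.
have Hp : (H < p)%N.
  rewrite -(ltr_nat R) -y100; apply: lt_le_trans L2y _.
  by have := @ypow 99 1 1; rewrite mul1r; apply; lra.
have [/existsP[i rt]|noroot] := boolP [exists i : 'I_H.+1, primitive_root (p ^ 2) i].
  exists i => //; rewrite -(ltr_nat R) !natrX -y100 exprAC.
  rewrite ltrXn2r // ?nnegrE ?ler0n ?exprn_ge0 ?ltW //; apply: le_lt_trans L2y.
  by rewrite ler_nat -ltnS ltn_ord.
have {}noroot n : (n <= H)%N -> ~~ primitive_root (p ^ 2) n.
  move=> nH; move: noroot; rewrite negb_exists => /forallP/(_ (inord n)).
  by rewrite inordK.
exfalso.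
(* This [w] is one more than the integer part of [sqrt p]. It serves both as the square root bound
   in the bilinear sum and as the gcd threshold [K]. *)
have [w wle wgt] : exists2 w : nat, w%:R <= y ^+ 50 + 1 & y ^+ 50 <= w%:R.
  exists (Num.truncn (y ^+ 50)).+1;
    have /andP[le lt] : (Num.truncn (y ^+ 50))%:R <= y ^+ 50
      < (Num.truncn (y ^+ 50)).+1%:R by apply: truncn_itv; exact: ltW.
    by rewrite -natr1 lerD2r.
  exact: ltW.
have pw : (p <= w ^ 2)%N.
  by rewrite -(ler_nat R) natrX -y100 (_ : 100 = 50 * 2)%N // exprM lerXn2r ?nnegrE ?ynn ?ler0n.
have w0 : (0 < w)%N by rewrite -(ltr0n R); apply: lt_le_trans wgt.
have wR : 0 < w%:R :> R by rewrite ltr0n.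
have := card_prim_roots_le prp oddp Hp w0 noroot.
have := prim_roots_le_bilinear prp oddp Hp (leqnn _) pw.
set s := #|_|; set n := p.-1 => bil card.
have n0 : (0 < n)%N by rewrite /n -subn1 subn_gt0 prime_gt1.
have np : n%:R <= y ^+ 100 by rewrite y100 ler_nat leq_pred.
have phi0 : 0 < (totient n)%:R :> R by rewrite ltr0n totient_gt0.
(* Dividing the energy bound by [w >= y^50] gives [(y^50 + 1) * y^100 / 2 + y^148]; [e5] and [e6]
   absorb the lower terms into [1.12^2 * y^150]. *)
have s2 : s%:R ^+ 2 <= (112%:R / 100%:R * y ^+ 75) ^+ 2.
  have half : (n./2)%:R <= y ^+ 100 / 2%:R.
    rewrite ler_pdivlMr // -natrM; apply: le_trans np; rewrite ler_nat muln2.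
    by rewrite -[leqRHS]odd_double_half leq_addl.
  have H2 : H%:R ^+ 2 <= w%:R * y ^+ 148.
    apply: le_trans (_ : (y ^+ 99) ^+ 2 <= _).
      by rewrite lerXn2r ?nnegrE ?ler0n ?ynn // ltW.
    by rewrite -exprM (_ : 99 * 2 = 50 + 148)%N // exprD ler_pM2r.
  rewrite -(ler_pM2l wR).
  move: card; rewrite -(ler_nat R) natrD !natrM -!expr2 => /le_trans; apply.
  apply: le_trans (_ : w%:R * (w%:R * (y ^+ 100 / 2%:R) + y ^+ 148) <= _).
    by rewrite mulrDr mulrA -expr2 lerD // ler_pM2l ?exprn_gt0.
  rewrite ler_pM2l // exprMn -exprM.
  apply: le_trans (_ : (y ^+ 50 + 1) * (y ^+ 100 / 2%:R) + y ^+ 148 <= _).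
    by rewrite lerD2r ler_pM2r // divr_gt0.
  rewrite mulrDl mulrA -exprD mul1r ?[(_ + _)%N]/= ?[(_ * _)%N]/=.
  by have := ypos 150; lra.
have {s2} sle : s%:R <= 112%:R / 100%:R * y ^+ 75.
  move: s2; rewrite ler_pXn2r // ?nnegrE ?ler0n // mulr_ge0 ?ynn //; lra.
(* The constant satisfies [3.36^20 >= (35/8)^20 / 210]. *)
have ratio : n%:R / (totient n)%:R <= 336%:R / 100%:R * y ^+ 5.
  have nn : 0 <= n%:R / (totient n)%:R :> R by rewrite divr_ge0 ?ler0n.
  have nn' : 0 <= 336%:R / 100%:R * y ^+ 5 by rewrite mulr_ge0 ?divr_ge0 ?ynn ?ler0n.
  rewrite -(@ler_pXn2r _ 20) ?nnegrE //.
  apply: le_trans (totient_ratio_le R n0) _.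
  rewrite [leRHS]exprMn -[y ^+ _ ^+ _]exprM ?[(_ * _)%N]/=.
  by clear - np; apply: ler_pM; rewrite ?mulr_ge0 ?divr_ge0 ?exprn_ge0 ?ler0n //; lra.
(* The constant satisfies [4.87^4 >= 559]. *)
have omega : (2 ^ size (primes n))%:R <= 487%:R / 100%:R * y ^+ 25.
  have nn' : 0 <= 487%:R / 100%:R * y ^+ 25 by rewrite mulr_ge0 ?divr_ge0 ?ynn ?ler0n.
  rewrite -(@ler_pXn2r _ 4) ?nnegrE ?ler0n //.
  rewrite natrX exprAC -natrX (_ : 2 ^ 4 = 16)%N //.
  apply: le_trans (exp16_omega_le R n0) _.
  rewrite [leRHS]exprMn -[y ^+ _ ^+ _]exprM ?[(_ * _)%N]/=.
  by clear - np; apply: ler_pM; rewrite ?mulr_ge0 ?divr_ge0 ?exprn_ge0 ?ler0n //; lra.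
have Lbound : L%:R <= n%:R / (totient n)%:R * s%:R + (2 ^ size (primes n)).-1%:R * w%:R :> R.
  rewrite -(ler_pM2l phi0) mulrDr.
  have -> : (totient n)%:R * (n%:R / (totient n)%:R * s%:R) = n%:R * s%:R :> R.
    by field; rewrite gt_eqF.
  by rewrite mulrA -!natrM -natrD ler_nat.
have t1 : n%:R / (totient n)%:R * s%:R <= 336%:R / 100%:R * y ^+ 5 * (112%:R / 100%:R * y ^+ 75).
  by rewrite ler_pM ?divr_ge0 ?ler0n.
have t2 : (2 ^ size (primes n)).-1%:R * w%:R <= 487%:R / 100%:R * y ^+ 25 * (y ^+ 50 + 1).
  rewrite ler_pM ?ler0n //; apply: le_trans omega; by rewrite ler_nat leq_pred.
have t3 : 336%:R / 100%:R * y ^+ 5 * (112%:R / 100%:R * y ^+ 75) =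
    336%:R / 100%:R * (112%:R / 100%:R) * y ^+ 80 by rewrite mulrACA -exprD.
have t4 : 487%:R / 100%:R * y ^+ 25 * (y ^+ 50 + 1) =
    487%:R / 100%:R * y ^+ 75 + 487%:R / 100%:R * y ^+ 25.
  by rewrite mulrDr mulr1 -mulrA -exprD.
rewrite t3 in t1; rewrite t4 in t2.
have L2 : L.*2%:R = 2%:R * L%:R :> R by rewrite -muln2 natrM mulrC.
rewrite L2 in Lgt.
clear - Lbound t1 t2 Lgt e1 e2 e3 e4.
lra.
Qed.

(** * Primes below 9000, by computation in binary arithmetic *)

Local Open Scope nat_scope.

Fixpoint powmod (m x : N) (e : positive) : N :=
  match e with
  | xH => N.modulo x m
  | xO e' => let y := powmod m x e' in N.modulo (N.mul y y) m
  | xI e' => let y := powmod m x e' in N.modulo (N.mul (N.mul y y) x) m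
  end.

Definition pow_neq1 (m x e : N) : bool :=
  if e is Npos e' then ~~ N.eqb (powmod m x e') 1%num else false.

Definition primes_lt97 : seq N :=
  [:: 2; 3; 5; 7; 11; 13; 17; 19; 23; 29; 31; 37; 41; 43; 47; 53; 59; 61; 67; 71; 73; 79; 83; 89]%num.

(* The tests below branch with [if] rather than [&&] and [||], which are strict
   under call-by-value evaluation. *)
Definition small_factor_ok (p g q : N) : bool :=
  if N.modulo (N.pred p) q is N0 then pow_neq1 p g (N.div (N.pred p) q) else true.

Fixpoint small_factor_test (qs : seq N) (p g : N) : bool :=
  if qs is q :: qs' then
    if small_factor_ok p g q then small_factor_test qs' p g else false
  else true.

Definition large_factor_ok (p g r : N) : bool :=
  if N.modulo (N.pred p) r is N0 then pow_neq1 p g r else true.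

(* A prime factor [q >= 97] of [p - 1] is not searched for: the cofactor
   [r = (p - 1) / q] is even and small, so all even divisors [r] are tested. *)
Fixpoint large_factor_test (k : nat) (r p g : N) : bool :=
  if k is k'.+1 then
    if N.leb (N.mul 97 r) p then
      if large_factor_ok p g r then large_factor_test k' (N.add r 2) p g else false
    else true
  else false.

(** With fuel 50, [r] can reach 100, past [p / 97] for every [p < 97^2]; running out of fuel
    rejects. *)
Definition root_test (p g : N) : bool :=
  if small_factor_test primes_lt97 p g then
    if large_factor_test 50 2 p g then pow_neq1 (N.mul p p) g (N.pred p) else false
  else false.

(** The search asks for [g < p / 2], which implies the required bound as long as [p <= 2^100]. *)
Fixpoint has_small_root (k : nat) (p g : N) : bool :=
  if k is k'.+1 then
    if N.ltb (N.mul 2 g) p then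
      if root_test p g then true else has_small_root k' p (N.succ g)
    else false
  else false.

Fixpoint has_factor (qs : seq N) (p : N) : bool :=
  if qs is q :: qs' then
    if (if N.modulo p q is N0 then N.ltb q p else false) then true else has_factor qs' p
  else false.

Definition check_one (p : N) : bool :=
  if has_factor primes_lt97 p then true else has_small_root 40 p 2.

Fixpoint check_odd (k : nat) (p : N) : bool :=
  if k is k'.+1 then if check_one p then check_odd k' (N.add p 2) else false else true.

Lemma check_odd_5_9001 : check_odd 4500 5 = true.
Proof. by vm_compute. Qed.

Lemma to_nat_mod (a m : N) : m <> 0%num -> N.to_nat (N.modulo a m) = N.to_nat a %% N.to_nat m.
Proof.
move=> m0; have lt := N.mod_lt a m m0.
rewrite {2}(N.div_mod a m m0) N2Nat.inj_add N2Nat.inj_mul.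
rewrite plusE multE mulnC modnMDl modn_small //.
by apply/ssrnat.ltP; lia.
Qed.

Lemma powmodE (m x : N) (e : positive) : m <> 0%num ->
  N.to_nat (powmod m x e) = N.to_nat x ^ BinPos.Pos.to_nat e %% N.to_nat m.
Proof.
move=> m0; elim: e => [e IH|e IH|] /=.
- rewrite to_nat_mod // !N2Nat.inj_mul !multE IH -modnMml modnMm modnMml mulnn mulnC.
  by rewrite -expnM -expnS; congr (_ ^ _ %% _); lia.
- rewrite to_nat_mod // !N2Nat.inj_mul !multE IH modnMm mulnn.
  by rewrite -expnM; congr (_ ^ _ %% _); lia.
- by rewrite to_nat_mod.
Qed.

Lemma pow_neq1P (m x e : N) : (1 < m)%num -> pow_neq1 m x e ->
  N.to_nat x ^ N.to_nat e != 1 %[mod N.to_nat m].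
Proof.
case: e => // e m1 /=; apply: contra => /eqP H; apply/N.eqb_eq; apply: N2Nat.inj.
rewrite powmodE; last by lia.
by rewrite H modn_small //; apply/ssrnat.ltP; lia.
Qed.

(** If the order [m] of [g] were a proper divisor of [p - 1], a prime [q] dividing [(p - 1) / m]
    would give [g^((p-1)/q) = 1]. *)
Lemma prim_root_of_prime_tests (p g : nat) : prime p -> 0 < g < p ->
  (forall q, prime q -> q %| p.-1 -> g ^ (p.-1 %/ q) != 1 %[mod p]) ->
  (p.-1.-primitive_root (g%:R : 'F_p))%R.
Proof.
move=> prp /andP[g0 gp] tests; have n0 : 0 < p.-1 by have := prime_gt1 prp; lia.
have gF : (g%:R != 0 :> 'F_p)%R by rewrite -[0%R]/(0%:R)%R eq_Fp_nat // mod0n modn_small // -lt0n.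
have gn : ((g%:R : 'F_p) ^+ p.-1 = 1)%R.
  apply: (mulfI gF); rewrite mulr1 -exprS prednK ?prime_gt0 //.
  by have := expf_card (g%:R : 'F_p)%R; rewrite card_Fp.
have [m prim_m mn] := prim_order_exists n0 gn.
have [<- //|neq] := eqVneq m p.-1.
have m0 := prim_order_gt0 prim_m.
have nm1 : 1 < p.-1 %/ m.
  by rewrite ltn_divRL // mul1n ltn_neqAle neq dvdn_leq.
have prq := pdiv_prime nm1; set q := pdiv _ in prq.
have /dvdnP[k ek] : q %| p.-1 %/ m by exact: pdiv_dvd.
have en : p.-1 = k * m * q by rewrite -(divnK mn) ek mulnAC.
have := tests q prq; rewrite [X in q %| X]en dvdn_mull // => /(_ isT)/negP[].
rewrite -eq_Fp_nat // natrX en mulnK ?prime_gt0 // mulnC exprM.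
by rewrite (prim_expr_order prim_m) expr1n.
Qed.

Lemma prime_lt97 q : prime q -> q < 97 -> N.of_nat q \in primes_lt97.
Proof.
have : all (fun q => prime q ==> (N.of_nat q \in primes_lt97)) (iota 0 97) by vm_compute.
by move=> /allP H prq q97; by move: (H q); rewrite mem_iota prq q97; exact.
Qed.

Lemma small_factor_testP qs p g q : (1 < p)%num -> small_factor_test qs p g -> q \in qs ->
  q <> 0%num -> N.to_nat q %| (N.to_nat p).-1 ->
  N.to_nat g ^ ((N.to_nat p).-1 %/ N.to_nat q) != 1 %[mod N.to_nat p].
Proof.
move=> p1; elim: qs => //= x qs IH; case E: small_factor_ok => // rest; rewrite inE => /orP[/eqP -> q0 qp|/IH]; last exact.
have em : N.modulo (N.pred p) x = 0%num.
  by apply: N2Nat.inj; rewrite to_nat_mod // N2Nat.inj_pred; apply/eqP.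
rewrite /small_factor_ok em in E; have := pow_neq1P p1 E.
suff -> : N.to_nat (N.div (N.pred p) x) = (N.to_nat p).-1 %/ N.to_nat x by [].
have := N.div_mod (N.pred p) x q0; rewrite em N.add_0_r => /(congr1 N.to_nat).
rewrite N2Nat.inj_mul N2Nat.inj_pred multE => ->; rewrite mulKn //; lia.
Qed.

Local Arguments N.mul : simpl never.
Local Arguments N.add : simpl never.

(** Induction on the fuel, with [d] the number of steps of 2 left from [r] to [s]. The early exit
    cannot precede [s], since [97 * s <= p]. *)
Lemma large_factor_testP k r p g s d : (1 < p)%num -> (0 < r)%num ->
  large_factor_test k r p g -> s = N.to_nat r + d.*2 ->
  97 * s <= N.to_nat p -> s %| (N.to_nat p).-1 ->
  N.to_nat g ^ s != 1 %[mod N.to_nat p].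
Proof.
move=> p1; elim: k r d => //= k IH r d r0.
case: N.leb_spec => [le|gt]; last by move=> _ ->; lia.
case E: large_factor_ok => // rest es s97 sp.
case: d es => [|d] es.
  rewrite addn0 in es; rewrite es in s97 sp *.
  have em : N.modulo (N.pred p) r = 0%num.
    by apply: N2Nat.inj; rewrite to_nat_mod ?N2Nat.inj_pred; [apply/eqP | lia].
  by rewrite /large_factor_ok em in E; exact: pow_neq1P p1 E.
by apply: (IH _ d _ rest) => //; lia.
Qed.

Lemma root_test_primitive_root (p : nat) (g : N) : prime p ->
  0 < N.to_nat g < p -> root_test (N.of_nat p) g -> p < 97 * 97 ->
  odd p -> primitive_root (p ^ 2) (N.to_nat g).
Proof.
move=> prp g0p; rewrite /root_test; case E1: small_factor_test => //.
case E2: large_factor_test => // E3 p97 oddp.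
have p2 := odd_prime_gt2 oddp prp; have p1 : (1 < N.of_nat p)%num by lia.
apply: primitive_root_sqr => //; last first.
  have mp1 : (1 < N.mul (N.of_nat p) (N.of_nat p))%num by nia.
  have := pow_neq1P mp1 E3.
  by rewrite N2Nat.inj_mul N2Nat.inj_pred Nat2N.id multE mulnn.
apply: prim_root_of_prime_tests => // q prq qp.
have [q97|q97] := ltnP q 97.
  have := small_factor_testP p1 E1 (prime_lt97 prq q97).
  by rewrite !Nat2N.id; apply => //; have := prime_gt0 prq; lia.
have /dvdnP[r er] := qp.
have r2 : 2 %| r.
  have : 2 %| p.-1 by rewrite dvdn2 -subn1 oddB ?oddp ?prime_gt0.
  rewrite er Gauss_dvdl // coprime2n; case: (even_prime prq) => // q2; lia.
case/dvdnP: r2 => t et.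
have r0 : 0 < r by rewrite lt0n; apply/eqP => r0; rewrite r0 in er; lia.
have -> : p.-1 %/ q = r by rewrite er mulnK ?prime_gt0.
(* The even cofactor is [r = 2t = 2 + 2(t - 1)], so the loop starting at 2 reaches it after [t - 1]
   steps. *)
have := @large_factor_testP 50 2 (N.of_nat p) g r t.-1 p1 _ E2; rewrite Nat2N.id.
by apply; rewrite ?er ?dvdn_mulr //; [lia | nia].
Qed.

Lemma has_small_rootP k p g : prime p -> odd p -> p < 97 * 97 -> (0 < g)%num ->
  has_small_root k (N.of_nat p) g ->
  exists2 n, primitive_root (p ^ 2) n & 2 * n < p.
Proof.
move=> prp oddp p97; elim: k g => //= k IH g g0.
case: N.ltb_spec => // gp; case E: root_test; last by apply: IH; lia.
move=> _; exists (N.to_nat g); last by lia.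
by apply: root_test_primitive_root E _ _ => //; lia.
Qed.

Lemma has_factorN qs p : prime p -> all (fun q => N.ltb 1 q) qs ->
  has_factor qs (N.of_nat p) = false.
Proof.
move=> prp; elim: qs => //= q qs IH /andP[q1 /IH ->].
have {}q1 : (1 < q)%num by apply/N.ltb_lt.
case E: (N.modulo _ _) => //; case: N.ltb_spec => // qp.
have : N.to_nat q %| p.
  have /(congr1 N.to_nat) := E; rewrite to_nat_mod ?Nat2N.id; last by lia.
  by move=> e; apply/eqP.
by case/primeP: prp => _ /[apply] /orP[] /eqP; lia.
Qed.

Lemma check_oddP k m j : check_odd k (N.of_nat m) -> j < k -> prime (m + j.*2) ->
  has_small_root 40 (N.of_nat (m + j.*2)) 2.
Proof.
elim: k m j => // k IH m j.
rewrite [check_odd _ _]/=; case: j => [|j].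
  rewrite addn0 /check_one => H _ prp; move: H; rewrite has_factorN //.
  by case: has_small_root.
case: check_one => // rest jk.
have -> : m + j.+1.*2 = m + 2 + j.*2 by lia.
by apply: IH => //; rewrite Nat2N.inj_add.
Qed.

(** From [p * n^k <= (2n)^k < p^k]. *)
Lemma small_root_half (p n : nat) (k : nat) : 0 < k -> 2 * n < p -> p <= 2 ^ k ->
  n ^ k < p ^ k.-1.
Proof.
move=> k0 np p2; have p0 : 0 < p by lia.
rewrite -(ltn_pmul2l p0) -expnS prednK //.
apply: leq_ltn_trans (_ : 2 ^ k * n ^ k < _); first by rewrite leq_mul2r p2 orbT.
by rewrite -expnMn ltn_exp2r.
Qed.

(** Meant for [k = 97], that is [2^100 < 3^99], where evaluating unary numbers is out of reach. *)
Lemma exp2_lt_exp3 k : 2 ^ k.+3 < 3 ^ k.+2.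
Proof.
elim: k => // k IH; rewrite expnS [X in _ < X]expnS.
by apply: leq_trans (leq_mul (leqnSn 2) IH); rewrite -[X in X < _]muln1 mulnS; lia.
Qed.

Lemma small_root_lt9000 (p : nat) : prime p -> odd p -> p < 9 * 10 ^ 3 -> small_root p.
Proof.
move=> prp oddp p9; have p2 := odd_prime_gt2 oddp prp.
(* The root 2 of [p = 3] is not below [p / 2], so this prime is treated separately. *)
have [p3|p3] := eqVneq p 3.
  rewrite p3; exists 2; last exact: (exp2_lt_exp3 97).
  by apply: (@root_test_primitive_root 3 2).
have p97 : p < 97 * 97 by lia.
have ep : 5 + ((p - 5)./2).*2 = p.
  by have := odd_double_half (p - 5); rewrite oddB ?oddp /=; lia.
have jk : (p - 5)./2 < 4500 by lia.
have := @check_oddP 4500 5 _ check_odd_5_9001 jk; rewrite ep => /(_ prp).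
have g0 : (0 < 2)%num by lia.
move/(has_small_rootP prp oddp p97 g0) => [n rt np].
exists n => //; apply: (@small_root_half p n 100) => //.
apply: leq_trans (_ : 2 ^ 14 <= _); first by lia.
by rewrite leq_exp2l.
Qed.

Local Open Scope ring_scope.

Theorem theorem1 (R : realType) (p : nat) (pr_p : prime p) (odd_p : odd p) :
  (least_primitive_root_sqr pr_p odd_p)%:R < p%:R `^ (99%:R / 100%:R) :> R.
Proof.
suff [n rt np] : small_root p by exact: least_primitive_root_sqr_lt rt np.
have [p9|p9] := ltnP p (9 * 10 ^ 3); first exact: small_root_lt9000.
have [p3|p3] := ltP (p%:R : R) (3%:R * 10%:R ^+ 6); last exact: small_root_large p3.
by apply: (@small_root_mid R) => //; rewrite p3 andbT -natrX -natrM ler_nat.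
Qed.
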